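(* Let $(\mathfrak{a},\ell_0,\ell_1,\dots,\ell_n)$ be a curved $L_n$ algebra, let $\mathfrak{a}'=\mathrm{Span}(\ell_2(\mathfrak{a},\mathfrak{a})+\ell_3(\mathfrak{a},\mathfrak{a},\mathfrak{a})+\dots+\ell_n(\mathfrak{a},\dots,\mathfrak{a}))$, let $\mathfrak{a}_{\mathrm{ab}}=\mathfrak{a}/\mathfrak{a}'$, and let $p:\mathfrak{a}\to\mathfrak{a}_{\mathrm{ab}}$ be the projection. Then: (1) The bracket $\ell_1$ descends to an operator $d$ on $\mathfrak{a}_{\mathrm{ab}}$. (2) The operator $d$ is a differential, that is, $d^2=0$. (3) The projection $p(\ell_0)$ of $\ell_0$ to the quotient is closed under $d$. (4) Denote by $\mathfrak{a}^\phi$ the curved $L_n$ algebra twisted by a degree $1$ element $\phi\in\mathfrak{a}$. Then $\mathfrak{a}'=(\mathfrak{a}^\phi)'$, and both the operator $d$ on the quotient and the cohomology class of $p(\ell_0)$ in $H(\mathfrak{a}_{\mathrm{ab}},d)$ are independent of the twist (that is, they coincide for $\mathfrak{a}$ and $\mathfrak{a}^\phi$).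
   Context: A curved $L_\infty$ algebra is a graded vector space $\mathfrak{a}$ (over a field of characteristic $0$, e.g. $\mathbb{R}$) with graded-antisymmetric maps $\ell_k:\mathfrak{a}^{\otimes k}\to\mathfrak{a}$ of degree $2-k$, $k=0,1,2,\dots$ ($\ell_0$ being an element of $\mathfrak{a}$ of degree $2$); graded antisymmetry means that swapping two adjacent homogeneous arguments $v,w$ multiplies the value by $-(-1)^{|v||w|}$. They satisfy, for all $n\ge0$ and homogeneous $v_1,\dots,v_n$, the higher Jacobi identity $$\sum_{i+j=n+1}\ \sum_{\sigma\in\mathrm{UnShuff}(i,j-1)}\chi(\sigma;v_1,\dots,v_n)(-1)^{i(n-i)}\ell_j(\ell_i(v_{\sigma(1)},\dots,v_{\sigma(i)}),v_{\sigma(i+1)},\dots,v_{\sigma(n)})=0,$$ with $i\ge0$, $j\ge1$, where $\mathrm{UnShuff}(i,j-1)$ is the set of permutations with $\sigma(1)<\dots<\sigma(i)$ and $\sigma(i+1)<\dots<\sigma(n)$, and $\chi$ is the antisymmetric Koszul sign (a factor $-(-1)^{|v||w|}$ for each swap of adjacent $v,w$). A curved $L_n$ algebra is a curved $L_\infty$ algebra with $\ell_k=0$ for $k>n$. Set $\varsigma(k)=-(-1)^{k(k+1)/2}$. For a degree $1$ element $\phi\in\mathfrak{a}$, the twist of $\mathfrak{a}$ by $\phi$ is the curved $L_n$ algebra $\mathfrak{a}^\phi=(\mathfrak{a},\ell_0^\phi,\dots,\ell_n^\phi)$ with $$\ell_k^\phi(\cdot,\dots,\cdot)=\varsigma(k)\sum_{i=k}^n\varsigma(i)\frac{1}{(i-k)!}\ell_i(\underbrace{\phi,\dots,\phi}_{i-k},\cdot,\dots,\cdot).$$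 $(\mathfrak{a}^\phi)'$ denotes the span of the images of $\ell_2^\phi,\dots,\ell_n^\phi$. *)

(* Defs.v *)
From HB Require Import structures.
From mathcomp Require Import all_boot all_order all_fingroup all_algebra.
From mathcomp Require Import generic_quotient ring_quotient boolp.

Set Implicit Arguments.
Unset Strict Implicit.
Unset Printing Implicit Defensive.

Import GRing.Theory.
Local Open Scope ring_scope.
Local Open Scope quotient_scope.

Section LinearAlgebra.
Variables (K : fieldType) (V : lmodType K).

Definition lspan (X : V -> Prop) : {pred V} :=
  fun x => `[< exists m (c : 'I_m -> K) (u : 'I_m -> V),
                 (forall i, X (u i)) /\ x = \sum_(i < m) c i *: u i >].

Lemma lspan_submod_closed (X : V -> Prop) : submod_closed (lspan X).
Proof.
split; first by apply/asboolP; exists 0%N, (fun=> 0), (fun=> 0); split;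
  [case | rewrite big_ord0].
move=> a x y /asboolP[m [c [u [Xu ->]]]] /asboolP[m' [c' [u' [Xu' ->]]]].
apply/asboolP; exists (m + m')%N.
exists (fun i => match split i with inl j => a * c j | inr j => c' j end).
exists (fun i => match split i with inl j => u j | inr j => u' j end).
split=> [i|]; first by case: (split i).
rewrite big_split_ord scaler_sumr /=; congr (_ + _); apply: eq_bigr => i _.
  by rewrite (unsplitK (inl i : 'I_m + 'I_m')) scalerA.
by rewrite (unsplitK (inr i : 'I_m + 'I_m')).
Qed.

HB.instance Definition _ (X : V -> Prop) :=
  GRing.isSubmodClosed.Build K V (lspan X) (lspan_submod_closed X).

(* The library's quotient by an additive subgroup is only a zmodType; [lquot S]
   is the same type equipped with the induced scaling. *)
Variable S : submodClosed V.

Definition submod_pred : {pred V} := fun x => x \in S.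
Lemma submod_pred_zmod_closed : zmod_closed submod_pred.
Proof. exact: GRing.submod_closedB (submodClosedP S). Qed.
HB.instance Definition _ :=
  GRing.isZmodClosed.Build V submod_pred submod_pred_zmod_closed.

Definition lquot : Type := Quotient.quot submod_pred.
HB.instance Definition _ := GRing.Zmodule.on lquot.

Definition lproj (x : V) : lquot := \pi_(Quotient.quot submod_pred) x.

Lemma lproj_eq x y : (lproj x == lproj y) = (x - y \in S).
Proof. exact: esym (Quotient.idealrBE submod_pred x y). Qed.

Lemma lproj_is_zmod_morphism : zmod_morphism lproj.
Proof. exact: (raddfB \pi_(Quotient.quot submod_pred)). Qed.
HB.instance Definition _ :=
  GRing.isZmodMorphism.Build V lquot lproj lproj_is_zmod_morphism.

Definition lrepr (q : lquot) : V := repr (q : Quotient.quot submod_pred).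

Lemma lreprK : cancel lrepr lproj.
Proof. by move=> q; apply: reprK. Qed.

Definition lquot_scale (a : K) (q : lquot) : lquot := lproj (a *: lrepr q).

Lemma lproj_scale a x : lquot_scale a (lproj x) = lproj (a *: x).
Proof.
apply/eqP; rewrite lproj_eq -scalerBr rpredZ // -lproj_eq.
by rewrite lreprK.
Qed.

Lemma lquot_scaleA a b q :
  lquot_scale a (lquot_scale b q) = lquot_scale (a * b) q.
Proof. by rewrite -[q]lreprK !lproj_scale scalerA. Qed.
Lemma lquot_scale1 : left_id 1 lquot_scale.
Proof. by move=> q; rewrite -[q]lreprK lproj_scale scale1r. Qed.
Lemma lquot_scaleDr : right_distributive lquot_scale +%R.
Proof.
move=> a q r; rewrite -[q]lreprK -[r]lreprK -raddfD !lproj_scale.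
by rewrite scalerDr raddfD.
Qed.
Lemma lquot_scaleDl q : {morph lquot_scale^~ q : a b / a + b}.
Proof.
by move=> a b /=; rewrite -[q]lreprK !lproj_scale scalerDl raddfD.
Qed.
HB.instance Definition _ := GRing.Zmodule_isLmodule.Build K lquot
  lquot_scaleA lquot_scale1 lquot_scaleDr lquot_scaleDl.

Lemma lproj_is_scalable : scalable lproj.
Proof. by move=> a x; rewrite -lproj_scale. Qed.
HB.instance Definition _ :=
  GRing.isScalable.Build K V lquot *:%R lproj lproj_is_scalable.

Definition descends (f : V -> V) (d : {linear lquot -> lquot}) : Prop :=
  forall x, d (lproj x) = lproj (f x).

End LinearAlgebra.

Section Cohomology.
Variables (K : fieldType) (V : lmodType K) (d : {linear V -> V}).

Definition cocycle_pred : {pred V} := fun y => d y == 0.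

Lemma cocycle_submod_closed : submod_closed cocycle_pred.
Proof.
split=> [|a x y]; rewrite !unfold_in ?raddf0 // => /eqP dx /eqP dy.
by rewrite linearP dx dy scaler0 addr0.
Qed.
HB.instance Definition _ :=
  GRing.isSubmodClosed.Build K V cocycle_pred cocycle_submod_closed.

Record cocycle := Cocycle { cocycle_val :> V; _ : cocycle_val \in cocycle_pred }.
HB.instance Definition _ := [isSub for cocycle_val].
HB.instance Definition _ := [Choice of cocycle by <:].
HB.instance Definition _ := [SubChoice_isSubLmodule of cocycle by <:].

Definition coboundary : {pred cocycle} :=
  fun y => `[< exists x : V, val y = d x >].

Lemma coboundary_submod_closed : submod_closed coboundary.
Proof.
split=> [|a x y]; first by apply/asboolP; exists 0; rewrite !raddf0.
move=> /asboolP[x' dx'] /asboolP[y' dy']; apply/asboolP.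
by exists (a *: x' + y'); rewrite linearP -dx' -dy' linearP.
Qed.
HB.instance Definition _ :=
  GRing.isSubmodClosed.Build K cocycle coboundary coboundary_submod_closed.

(* Ker d / (Im d :&: Ker d), i.e. Ker d / Im d when d^2 = 0. *)
Definition cohomology := lquot coboundary.

Lemma mem_cocycle y : d y = 0 -> y \in cocycle_pred.
Proof. by move=> dy; rewrite unfold_in dy. Qed.

Definition cohomology_class y (dy : d y = 0) : cohomology :=
  lproj coboundary (Cocycle (mem_cocycle dy)).

End Cohomology.

Section CurvedLinfty.
Variables (K : fieldType) (A : lmodType K).

(* gr i is the subspace of elements of degree i, and A is the direct sum of
   the gr i, for i ranging over all integers. *)
Record is_grading (gr : int -> {pred A}) : Prop := IsGrading {
  grading_submod : forall i, submod_closed (gr i);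
  grading_span : forall x, exists (s : seq int) (f : int -> A),
    (forall i, f i \in gr i) /\ x = \sum_(i <- s) f i;
  grading_direct : forall (s : seq int) (f : int -> A),
    uniq s -> (forall i, f i \in gr i) -> \sum_(i <- s) f i = 0 ->
    forall i, i \in s -> f i = 0 }.

Definition unshuffle n (i : nat) (s : 'S_n) : bool :=
  [forall a : 'I_n, forall b : 'I_n,
     ((a < b)%N && ((b < i)%N || (i <= a)%N)) ==> (s a < s b)%N].

(* The antisymmetric Koszul sign of (v_0, ..., v_n-1) |-> (v_(s 0), ...), with
   deg a the degree of v_a: each inversion of s is one adjacent swap in a
   shortest sequence of adjacent swaps realizing s. *)
Definition koszul n (s : 'S_n) (deg : 'I_n -> int) : K :=
  \prod_(a < n) \prod_(b < n | (a < b)%N && (s b < s a)%N)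
     (- (-1) ^ (deg (s a) * deg (s b))).

(* A family of brackets l_k : A^k -> A, k = 0, 1, 2, ..., is encoded as a
   single function l : seq A -> A, whose restriction to sequences of length k
   is l_k; thus l_0 is [l [::]] and l_1 x is [l [:: x]]. In [linfty_jacobi],
   the bracket l_j of the formula has j = n - i + 1. *)
Record curvedLinfty (gr : int -> {pred A}) (l : seq A -> A) : Prop :=
  CurvedLinfty {
  linfty_grading : is_grading gr;
  linfty_multilinear : forall (s t : seq A) (a : K) (x y : A),
    l (s ++ (a *: x + y) :: t) = a *: l (s ++ x :: t) + l (s ++ y :: t);
  linfty_degree : forall (n : nat) (deg : 'I_n -> int) (v : 'I_n -> A),
    (forall a, v a \in gr (deg a)) ->
    l [seq v a | a <- enum 'I_n] \in gr (2 - n%:Z + \sum_(a < n) deg a);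
  linfty_antisym : forall (s t : seq A) (i j : int) (v w : A),
    v \in gr i -> w \in gr j ->
    l (s ++ v :: w :: t) = (- (-1) ^ (i * j)) *: l (s ++ w :: v :: t);
  linfty_jacobi : forall (n : nat) (deg : 'I_n -> int) (v : 'I_n -> A),
    (forall a, v a \in gr (deg a)) ->
    \sum_(i < n.+1) \sum_(s : 'S_n | unshuffle i s)
      (koszul s deg * (-1) ^+ (i * (n - i))) *:
        l (l [seq v (s a) | a : 'I_n <- enum 'I_n & (a < i)%N]
             :: [seq v (s a) | a : 'I_n <- enum 'I_n & (i <= a)%N]) = 0 }.

Definition curvedLn (n : nat) (gr : int -> {pred A}) (l : seq A -> A) : Prop :=
  curvedLinfty gr l /\ (forall s, (n < size s)%N -> l s = 0).

Definition varsig (k : nat) : K := - (-1) ^+ ((k * k.+1) %/ 2).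

Definition twist (n : nat) (l : seq A -> A) (phi : A) (s : seq A) : A :=
  varsig (size s) *:
    \sum_(size s <= i < n.+1)
      (varsig i / ((i - size s)`!)%:R) *: l (nseq (i - size s) phi ++ s).

Definition derived (n : nat) (l : seq A -> A) : {pred A} :=
  lspan (fun x => exists2 s : seq A, (2 <= size s <= n)%N & x = l s).
HB.instance Definition _ (n : nat) (l : seq A -> A) :=
  GRing.SubmodClosed.on (derived n l).

Definition abelianization (n : nat) (l : seq A -> A) : lmodType K :=
  lquot (derived n l).

End CurvedLinfty.

(* Main.v *)
Require Import Defs.
From HB Require Import structures.
From mathcomp Require Import all_boot all_order all_fingroup all_algebra.
From mathcomp Require Import boolp.

Set Implicit Arguments.
Unset Strict Implicit.
Unset Printing Implicit Defensive.

Import GRing.Theory.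
Local Open Scope ring_scope.

(** The Jacobi identity on v_1, ..., v_m contains a single term whose outer
    bracket is unary, namely l_1 (l_m (v_1, ..., v_m)); all the others lie in
    a'. Hence l_1 maps the image of every bracket into a': for m >= 2 this says
    that l_1 descends to the quotient, for m = 1 that d^2 = 0, and for m = 0
    that p(l_0) is closed.

    Since varsig(k)^2 = 1, the twisted bracket of arity k is l_k plus multiples
    of brackets of arity > k of l. Downward induction on k gives
    a' = (a^phi)', the case k = 1 gives the invariance of d, and the case k = 0
    shows that p(l_0^phi) = p(l_0) - d(p(phi)). *)

Section Submodules.
Context {K : fieldType} {V : lmodType K}.

Lemma mem_lspan (X : V -> Prop) x : X x -> x \in lspan X.
Proof.
move=> Xx; apply/asboolP; exists 1%N, (fun=> 1), (fun=> x); split=> //.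
by rewrite big_ord1 scale1r.
Qed.

Lemma lspan_subset (X : V -> Prop) (S : submodClosed V) :
  (forall x, X x -> x \in S) -> {subset lspan X <= S}.
Proof.
move=> XS x /asboolP[m [c [u [Xu ->]]]]; apply: rpred_sum => i _.
by rewrite rpredZ // XS.
Qed.

Lemma linear_descends (S : submodClosed V) (f : V -> V) :
  linear f -> (forall x, x \in S -> f x \in S) ->
  exists d : {linear lquot S -> lquot S}, descends f d.
Proof.
move=> lin_f fS.
have fB x y : f (x - y) = f x - f y.
  by rewrite addrC -scaleN1r lin_f scaleN1r addrC.
pose d0 (q : lquot S) : lquot S := lproj S (f (lrepr q)).
have d0E x : d0 (lproj S x) = lproj S (f x).
  by apply/eqP; rewrite lproj_eq -fB fS // -lproj_eq lreprK.
have lin_d : linear d0.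
  move=> a q r; rewrite -[q]lreprK -[r]lreprK -linearP !d0E.
  by rewrite lin_f linearP.
pose dM := GRing.isLinear.Build K (lquot S) (lquot S) _ d0 lin_d.
pose d : {linear lquot S -> lquot S} := HB.pack d0 dM.
by exists d => x; apply: d0E.
Qed.

End Submodules.

Section Multilinear.
Context {K : fieldType} {A : lmodType K}.
Implicit Type l : seq A -> A.

Definition multilinear l := forall (s t : seq A) (a : K) (x y : A),
  l (s ++ (a *: x + y) :: t) = a *: l (s ++ x :: t) + l (s ++ y :: t).

Lemma multilinear0 l s t : multilinear l -> l (s ++ 0 :: t) = 0.
Proof.
move=> lM; have := lM s t (-1) 0 0.
by rewrite scaler0 addr0 scaleN1r addNr.
Qed.

Lemma multilinear_sum l s t (I : Type) (r : seq I) (f : I -> A) :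
  multilinear l ->
  l (s ++ (\sum_(i <- r) f i) :: t) = \sum_(i <- r) l (s ++ f i :: t).
Proof.
move=> lM; elim: r => [|i r IH]; first by rewrite !big_nil multilinear0.
by rewrite !big_cons -IH -[f i in LHS]scale1r lM scale1r.
Qed.

Lemma multilinear_unary l : multilinear l -> linear (fun x => l [:: x]).
Proof. by move=> lM a x y; apply: (lM [::] [::]). Qed.

Definition homogeneous (gr : int -> {pred A}) (x : A) := exists i, x \in gr i.

(** The Jacobi identity is only available on homogeneous arguments. Expanding each argument into its
    finitely many homogeneous components lifts this restriction, since [S] is stable under sums. *)
Lemma multilinear_ext gr l (S : submodClosed A) :
    is_grading gr -> multilinear l ->
    (forall s, (forall x, x \in s -> homogeneous gr x) -> l s \in S) ->
  forall s, l s \in S.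
Proof.
(* Induct on the tail still to be expanded, behind a homogeneous prefix that starts empty. *)
move=> grA lM lS t; rewrite -[t]cat0s.
have: forall x, x \in [::] -> homogeneous gr x by [].
elim: t [::] => [|x t IH] s s_hom; first by rewrite cats0 lS.
have [r [f [f_hom ->]]] := grading_span grA x.
rewrite multilinear_sum //; apply: rpred_sum => i _.
rewrite -cat_rcons; apply: IH => y; rewrite mem_rcons inE => /predU1P[->|].
  by exists i.
exact: s_hom.
Qed.

End Multilinear.

(** With a first block of full length, [s] is strictly increasing, so its values list [0, ..., n-1]
    in sorted order. *)
Lemma unshuffle_id n (s : 'S_n) : unshuffle n s -> s = 1%g.
Proof.
move=> /forallP sh; have s_mono (a b : 'I_n) : (a < b)%N -> (s a < s b)%N.
  by move=> ab; have /forallP/(_ b)/implyP := sh a; apply; rewrite ab ltn_ord.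
have val_sorted : [seq val (s a) | a <- enum 'I_n] = iota 0 n.
  apply: (irr_sorted_eq ltn_trans ltnn).
  - rewrite sorted_map; apply: sub_sorted (_ : sorted (relpre val ltn) _).
      exact: s_mono.
    by rewrite -sorted_map val_enum_ord iota_ltn_sorted.
  - exact: iota_ltn_sorted.
  move=> k; rewrite mem_iota /=; apply/mapP/idP => [[a _ ->] // | kn].
  by exists ((s^-1)%g (Ordinal kn)); rewrite ?mem_enum // permKV.
apply/permP => a; rewrite perm1; apply: val_inj.
have := congr1 (nth 0%N ^~ a) val_sorted.
rewrite nth_iota // add0n (nth_map a) ?size_enum_ord //.
by rewrite nth_ord_enum.
Qed.

Lemma unshuffle1 n i : @unshuffle n i 1%g.
Proof.
by apply/forallP=> a; apply/forallP=> b; rewrite !perm1; apply/implyP => /andP[].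
Qed.

Lemma koszul1 (K : fieldType) n (deg : 'I_n -> int) : koszul K 1%g deg = 1.
Proof.
rewrite /koszul big1 // => a _; apply: big1 => b.
by rewrite !perm1 => /andP[ab ba]; have := ltn_trans ab ba; rewrite ltnn.
Qed.

Lemma map_nth_enum_ord (T : Type) (x0 : T) (s : seq T) :
  [seq nth x0 s a | a : 'I_(size s) <- enum 'I_(size s)] = s.
Proof.
by rewrite (map_comp (nth x0 s) val) val_enum_ord -/(mkseq _ _) mkseq_nth.
Qed.

Section Twist.
Context {K : fieldType} {A : lmodType K}.
Context {n : nat} {l : seq A -> A}.
Hypothesis l_eq0 : forall s, (n < size s)%N -> l s = 0.

Lemma mem_derived s : (1 < size s)%N -> l s \in derived n l.
Proof.
move=> s2; have [sn|ns] := leqP (size s) n; last by rewrite l_eq0 ?rpred0.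
by apply: mem_lspan; exists s; rewrite ?s2.
Qed.

Lemma varsig_sqr k : varsig K k * varsig K k = 1.
Proof. by rewrite /varsig mulrNN -expr2 sqrr_sign. Qed.

Lemma twistE phi s :
  twist n l phi s = l s + varsig K (size s) *:
    \sum_((size s).+1 <= i < n.+1)
      (varsig K i / ((i - size s)`!)%:R) *: l (nseq (i - size s) phi ++ s).
Proof.
rewrite /twist; have [sn|ns] := leqP (size s) n.
  rewrite big_ltn // subnn invr1 mulr1 scalerDr scalerA varsig_sqr.
  by rewrite scale1r.
by rewrite l_eq0 // !big_geq ?scaler0 ?addr0 // ltnW.
Qed.

(** The correction terms in [twistE] are brackets of larger arity. Leaving [S] free allows both the
    derived subspace of [l] and that of its twist. *)
Lemma twist_sub_mem (S : submodClosed A) phi s :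
    (forall t, (size s < size t)%N -> l t \in S) ->
  twist n l phi s - l s \in S.
Proof.
move=> lS; rewrite twistE addrC addKr; apply: rpredZ.
rewrite big_nat_cond; apply: rpred_sum => i /andP[/andP[si _] _].
by apply/rpredZ/lS; rewrite size_cat size_nseq subnK // ltnW.
Qed.

Lemma derived_twist phi : derived n l = derived n (twist n l phi).
Proof.
have lphiD s : (1 < size s)%N -> l s \in derived n (twist n l phi).
  (* This measure encodes downward induction on the arity; with [n.+1] instead of [n] it still drops
     strictly when passing beyond arity [n]. *)
  have [k] := ubnP (n.+1 - size s); elim: k s => // k IH s sk s2.
  have [sn|ns] := leqP (size s) n; last by rewrite l_eq0 ?rpred0.
  rewrite -(subKr (twist n l phi s) (l s)) rpredB //.
    by apply: mem_lspan; exists s; rewrite ?s2.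
  apply: twist_sub_mem => t st; apply: IH (ltn_trans s2 st).
  by rewrite -ltnS (leq_trans _ sk) // ltnS ltn_sub2l.
apply/funext => x; apply/idP/idP; apply: lspan_subset => {}x [s /andP[s2 sn] ->].
  exact: lphiD.
rewrite -[twist _ _ _ _](subrK (l s)) rpredD ?mem_derived //.
by apply: twist_sub_mem => t st; apply/mem_derived/(ltn_trans s2 st).
Qed.

(** As [varsig 0 = -1] and [varsig 1 = 1], the twisted curvature is [l [::] - l [:: phi]] plus
    brackets of arity at least 2. *)
Lemma twist_curvature (S : submodClosed A) phi :
    (forall t, (1 < size t)%N -> l t \in S) ->
  l [::] - twist n l phi [::] - l [:: phi] \in S.
Proof.
move=> lS; rewrite twistE opprD addNKr /varsig !scaleN1r opprK.
(* For [n = 0] the sum has no unary term to cancel, but [l [:: phi]] itself vanishes. *)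
have [n0|n_gt0] := posnP n.
  by rewrite n0 big_geq // l_eq0 ?n0 // subr0 rpred0.
rewrite big_ltn //= expr1 opprK divr1 scale1r [X in X - _]addrC addrK.
rewrite big_nat_cond; apply: rpred_sum => i /andP[/andP[i_gt1 _] _].
by apply/rpredZ/lS; rewrite size_cat size_nseq addn0 subn0.
Qed.

End Twist.

Section CurvedLn.
Context {K : fieldType} {A : lmodType K} {gr : int -> {pred A}}.
Context {n : nat} {l : seq A -> A}.
Hypothesis Al : curvedLn n gr l.

Let lM : multilinear l := linfty_multilinear Al.1.

(** This isolates the summand [i = m]: its only unshuffle is the identity, and both of its signs are
    1. *)
Lemma jacobi_unary_term (m : nat) (deg : 'I_m -> int) (v : 'I_m -> A) :
    (forall a, v a \in gr (deg a)) ->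
  l [:: l [seq v a | a <- enum 'I_m]] =
  - \sum_(i < m) \sum_(s : 'S_m | unshuffle i s)
      (koszul K s deg * (-1) ^+ (i * (m - i))) *:
        l (l [seq v (s a) | a : 'I_m <- enum 'I_m & (a < i)%N]
             :: [seq v (s a) | a : 'I_m <- enum 'I_m & (i <= a)%N]).
Proof.
move=> v_deg; have := linfty_jacobi Al.1 v_deg.
rewrite big_ord_recr /= addrC => /eqP; rewrite addr_eq0 => /eqP <-.
rewrite (big_pred1 (1%g : 'S_m)) => [|s]; last first.
  by apply/idP/eqP => [/unshuffle_id // | ->]; apply: unshuffle1.
rewrite koszul1 subnn muln0 expr0 mulr1 scale1r.
rewrite (eq_filter (a2 := predT)) ?filter_predT => [|a]; last exact: ltn_ord.
rewrite (eq_filter (a2 := pred0)) ?filter_pred0 => [|a]; last first.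
  by rewrite /= leqNgt ltn_ord.
by congr (l [:: l _]); apply: eq_map => a; rewrite perm1.
Qed.

(** For [m = 0] there are no other terms, so the equality is exact and not merely modulo the derived
    subspace. *)
Lemma unary_closed_curvature : l [:: l [::]] = 0.
Proof.
have := @jacobi_unary_term 0 (fun=> 0) (fun=> 0).
by rewrite enum_ord0 big_ord0 oppr0; apply; case.
Qed.

Lemma unary_bracket_derived s : l [:: l s] \in derived n l.
Proof.
move: s; apply: (multilinear_ext (gr := gr) (l := fun s => l [:: l s]))
  => [||s s_hom].
- exact: linfty_grading Al.1.
- by move=> s t a x y; rewrite lM (multilinear_unary lM).
have /choice[deg degP] (a : 'I_(size s)) : homogeneous gr (nth 0 s a).
  by apply: s_hom; rewrite mem_nth.
have := jacobi_unary_term degP; rewrite map_nth_enum_ord => ->.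
rewrite rpredN; apply: rpred_sum => i _; apply: rpred_sum => sg _.
(* Since [i < m], the index [i] itself survives the filter [i <= a], so the outer bracket has at
   least two arguments. *)
apply/rpredZ/(mem_derived Al.2); rewrite /= ltnS size_map size_filter -has_count.
by apply/hasP; exists i; rewrite ?mem_enum /=.
Qed.

Lemma unary_derived x : x \in derived n l -> l [:: x] \in derived n l.
Proof.
case/asboolP=> m [c [u [uD ->]]].
rewrite (multilinear_sum [::] [::]) //; apply: rpred_sum => i _.
(* Adding 0 gives the shape [a *: x + y] required by linearity. *)
have [s _ ->] := uD i; rewrite -[c i *: _]addr0 (multilinear_unary lM).
rewrite rpredD ?rpredZ ?unary_bracket_derived //.
by rewrite (multilinear0 [::] [::]) ?rpred0.
Qed.

End CurvedLn.

Theorem propositionA7 (K : fieldType) (charK0 : [pchar K] =i pred0)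
    (A : lmodType K) (gr : int -> {pred A}) (n : nat) (l : seq A -> A)
    (Al : curvedLn n gr l) :
  let p : A -> abelianization n l := lproj (derived n l) in
  exists d : {linear abelianization n l -> abelianization n l},
  [/\ descends (fun x => l [:: x]) d,
      forall y, d (d y) = 0,
      d (p (l [::])) = 0 &
      forall phi, phi \in gr 1 ->
      let lphi := twist n l phi in
      [/\ derived n l = derived n lphi,
          descends (fun x => lphi [:: x]) d &
          exists (c : d (p (l [::])) = 0) (cphi : d (p (lphi [::])) = 0),
            cohomology_class c = cohomology_class cphi]].
Proof.
move=> p; have [Ainf l_eq0] := Al; have lM := linfty_multilinear Ainf.
have [d dE] := linear_descends (multilinear_unary lM) (unary_derived Al).
have dp x : d (p x) = p (l [:: x]) by apply: dE.
have p_eq x y : x - y \in derived n l -> p x = p y.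
  by move=> xy; apply/eqP; rewrite lproj_eq.
have dd y : d (d y) = 0.
  have [x ->] : exists x, y = p x by exists (lrepr y); rewrite /p lreprK.
  rewrite !dp -(raddf0 p); apply: p_eq; rewrite subr0.
  exact: (unary_bracket_derived Al).
have dl0 : d (p (l [::])) = 0.
  by rewrite dp (unary_closed_curvature Al); apply: (raddf0 p).
exists d; split=> // phi _ /=.
(* The two curvatures differ by a coboundary with primitive [p phi]; closedness of the twisted one
   then follows from [dd]. *)
have p_curv : p (l [::]) - p (twist n l phi [::]) = d (p phi).
  rewrite dp -(raddfB p); apply: p_eq.
  by apply: twist_curvature => // t; apply: mem_derived.
split.
- exact: derived_twist.
- move=> x; rewrite dE; apply/esym/p_eq.
  by apply: twist_sub_mem => // t; apply: mem_derived.
have dlphi0 : d (p (twist n l phi [::])) = 0.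
  by rewrite -[p _](subKr (p (l [::]))) p_curv raddfB /= dl0 dd subr0.
exists dl0, dlphi0; apply/eqP; rewrite lproj_eq; apply/asboolP.
by exists (p phi); rewrite -p_curv.
Qed.
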